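(* Every fMV-algebra is a subdirect product of totally-ordered fMV-algebras.
   Context: An MV-algebra is a structure $(A,\oplus,{}^*,0)$ with $(A,\oplus,0)$ a commutative monoid, $(x^* )^*=x$, $x\oplus 0^*=0^*$ and $(x^*\oplus y)^*\oplus y=(y^*\oplus x)^*\oplus x$; put $1=0^*$, $x\odot y=(x^*\oplus y^* )^*$, order $x\le y$ iff $x\odot y^*=0$ (a lattice order, $x\wedge y=x\odot(x^*\oplus y)$). A PMVf-algebra is an MV-algebra with an associative binary operation $\cdot$ satisfying $z\cdot(x\odot(x\wedge y)^* )=(z\cdot x)\odot(z\cdot(x\wedge y))^*$, $(x\odot(x\wedge y)^* )\cdot z=(x\cdot z)\odot((x\wedge y)\cdot z)^*$, and: $x\wedge y=0$ implies $(x\cdot z)\wedge y=(z\cdot x)\wedge y=0$. A Riesz MV-algebra is an MV-algebra with unary operations $x\mapsto\alpha x$ ($\alpha\in[0,1]$) with $\alpha(x\odot y^* )=(\alpha x)\odot(\alpha y)^*$, $\max(0,\alpha-\beta)x=(\alpha x)\odot(\beta x)^*$, $\alpha(\beta x)=(\alpha\beta)x$, $1x=x$. An fMV-algebra is a structure $(A,\oplus,\cdot,{}^*,\{\alpha\}_{\alpha\in[0,1]},0)$ which is a PMVf-algebra and a Riesz MV-algebra (sharing the MV-structure) satisfying $\alpha(x\cdot y)=(\alpha x)\cdot y=x\cdot(\alpha y)$. It is totally ordered if the order $\le$ is total. Subdirect products are taken in the sense of universal algebra for the signature of fMV-algebras. *)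

(* Defs.v *)
From HB Require Import structures.
From mathcomp Require Import all_boot all_order all_algebra.
From mathcomp Require Import boolp reals interval_inference.

Set Implicit Arguments.
Unset Strict Implicit.
Unset Printing Implicit Defensive.

Declare Scope mv_scope.
Delimit Scope mv_scope with MV.
Local Open Scope mv_scope.

Reserved Notation "x ⊕ y" (at level 50, left associativity).
Reserved Notation "x ⊙ y" (at level 40, left associativity).

(* Carriers are bare types: all the equations below are Leibniz equalities
   in Prop, and no decidable equality or choice operator is required. *)
HB.mixin Record isMVAlgebra (A : Type) := {
  mv_add : A -> A -> A;
  mv_neg : A -> A;
  mv_zero : A;
  mv_addA : forall x y z, mv_add x (mv_add y z) = mv_add (mv_add x y) z;
  mv_addC : forall x y, mv_add x y = mv_add y x;
  mv_addx0 : forall x, mv_add x mv_zero = x;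
  mv_negK : forall x, mv_neg (mv_neg x) = x;
  mv_addx1 : forall x, mv_add x (mv_neg mv_zero) = mv_neg mv_zero;
  mv_lukasiewicz : forall x y,
    mv_add (mv_neg (mv_add (mv_neg x) y)) y =
    mv_add (mv_neg (mv_add (mv_neg y) x)) x }.

#[short(type="mvType")]
HB.structure Definition MVAlgebra := {A of isMVAlgebra A}.

Notation "0" := mv_zero : mv_scope.
Notation "x ⊕ y" := (mv_add x y) : mv_scope.
Notation "x ^*" := (mv_neg x) : mv_scope.

Definition mv_odot (A : mvType) (x y : A) : A := (x^* ⊕ y^*)^*.
Notation "x ⊙ y" := (mv_odot x y) : mv_scope.

Definition mv_le (A : mvType) (x y : A) : Prop := x ⊙ y^* = 0.
Notation "x <= y" := (mv_le x y) : mv_scope.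

Definition mv_meet (A : mvType) (x y : A) : A := x ⊙ (x^* ⊕ y).
Notation "x `&` y" := (mv_meet x y) : mv_scope.

Definition mv_totally_ordered (A : mvType) : Prop :=
  forall x y : A, x <= y \/ y <= x.

HB.mixin Record MVAlgebra_isPMVf A of MVAlgebra A := {
  pmv_mul : A -> A -> A;
  pmv_mulA : forall x y z, pmv_mul x (pmv_mul y z) = pmv_mul (pmv_mul x y) z;
  pmv_mul_subr : forall x y z : A,
    pmv_mul z (x ⊙ (x `&` y)^*) = pmv_mul z x ⊙ (pmv_mul z (x `&` y))^*;
  pmv_mul_subl : forall x y z : A,
    pmv_mul (x ⊙ (x `&` y)^*) z = pmv_mul x z ⊙ (pmv_mul (x `&` y) z)^*;
  pmvf_meet_mulr : forall x y z : A, x `&` y = 0 -> pmv_mul x z `&` y = 0;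
  pmvf_meet_mull : forall x y z : A, x `&` y = 0 -> pmv_mul z x `&` y = 0 }.

#[short(type="pmvfType")]
HB.structure Definition PMVfAlgebra :=
  {A of MVAlgebra A & MVAlgebra_isPMVf A}.

Notation "x * y" := (pmv_mul x y) : mv_scope.

HB.mixin Record MVAlgebra_isRiesz (R : realType) A of MVAlgebra A := {
  rmv_scale : {i01 R} -> A -> A;
  rmv_scale_sub : forall a (x y : A),
    rmv_scale a (x ⊙ y^*) = rmv_scale a x ⊙ (rmv_scale a y)^*;
  rmv_sub_scale : forall (a b : {i01 R}) (x : A),
    rmv_scale (Num.max 0 (a%:num - b%:num))%R%:i01%R x =
    rmv_scale a x ⊙ (rmv_scale b x)^*;
  rmv_scaleA : forall (a b : {i01 R}) (x : A),
    rmv_scale a (rmv_scale b x) = rmv_scale (a%:num * b%:num)%R%:i01%R x;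
  rmv_scale1 : forall x : A, rmv_scale 1%R%:i01%R x = x }.

#[short(type="rieszMVType")]
HB.structure Definition RieszMVAlgebra (R : realType) :=
  {A of MVAlgebra A & MVAlgebra_isRiesz R A}.

Notation "a *: x" := (rmv_scale a x) : mv_scope.

HB.mixin Record PMVf_Riesz_isFMV (R : realType) A
    of PMVfAlgebra A & RieszMVAlgebra R A := {
  fmv_scaleAl : forall (a : {i01 R}) (x y : A), a *: (x * y) = (a *: x) * y;
  fmv_scaleAr : forall (a : {i01 R}) (x y : A), a *: (x * y) = x * (a *: y) }.

#[short(type="fmvType")]
HB.structure Definition FMVAlgebra (R : realType) :=
  {A of PMVfAlgebra A & RieszMVAlgebra R A & PMVf_Riesz_isFMV R A}.

Record fmv_morphism (R : realType) (A B : fmvType R) (f : A -> B) : Prop := {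
  fmv_morph0 : f 0 = 0;
  fmv_morphD : forall x y, f (x ⊕ y) = f x ⊕ f y;
  fmv_morphN : forall x, f (x^*) = (f x)^*;
  fmv_morphM : forall x y, f (x * y) = f x * f y;
  fmv_morphZ : forall (a : {i01 R}) x, f (a *: x) = a *: f x }.

Definition fmv_prod (R : realType) (I : Type) (B : I -> fmvType R) : Type :=
  forall i, B i.

Section ProductAlgebra.
Variables (R : realType) (I : Type) (B : I -> fmvType R).
Local Notation P := (fmv_prod B).

Let padd (x y : P) : P := fun i => x i ⊕ y i.
Let pneg (x : P) : P := fun i => (x i)^*.
Let pzero : P := fun i => 0.
Let pmul (x y : P) : P := fun i => x i * y i.
Let pscale (a : {i01 R}) (x : P) : P := fun i => a *: x i.

Let paddA x y z : padd x (padd y z) = padd (padd x y) z.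
Proof. by apply: functional_extensionality_dep => i; apply: mv_addA. Qed.
Let paddC x y : padd x y = padd y x.
Proof. by apply: functional_extensionality_dep => i; apply: mv_addC. Qed.
Let paddx0 x : padd x pzero = x.
Proof. by apply: functional_extensionality_dep => i; apply: mv_addx0. Qed.
Let pnegK x : pneg (pneg x) = x.
Proof. by apply: functional_extensionality_dep => i; apply: mv_negK. Qed.
Let paddx1 x : padd x (pneg pzero) = pneg pzero.
Proof. by apply: functional_extensionality_dep => i; apply: mv_addx1. Qed.
Let plukasiewicz x y :
  padd (pneg (padd (pneg x) y)) y = padd (pneg (padd (pneg y) x)) x.
Proof. by apply: functional_extensionality_dep => i; apply: mv_lukasiewicz. Qed.

HB.instance Definition _ := isMVAlgebra.Build P
  paddA paddC paddx0 pnegK paddx1 plukasiewicz.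

Let pmulA x y z : pmul x (pmul y z) = pmul (pmul x y) z.
Proof. by apply: functional_extensionality_dep => i; apply: pmv_mulA. Qed.
Let pmul_subr (x y z : P) :
  pmul z (x ⊙ (x `&` y)^*) = pmul z x ⊙ (pmul z (x `&` y))^*.
Proof. by apply: functional_extensionality_dep => i; apply: pmv_mul_subr. Qed.
Let pmul_subl (x y z : P) :
  pmul (x ⊙ (x `&` y)^*) z = pmul x z ⊙ (pmul (x `&` y) z)^*.
Proof. by apply: functional_extensionality_dep => i; apply: pmv_mul_subl. Qed.
Let pmeet_mulr (x y z : P) : x `&` y = 0 -> pmul x z `&` y = 0.
Proof.
move=> xy0; apply: functional_extensionality_dep => i.
by apply: pmvf_meet_mulr; apply: (congr1 (fun u : P => u i) xy0).
Qed.
Let pmeet_mull (x y z : P) : x `&` y = 0 -> pmul z x `&` y = 0.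
Proof.
move=> xy0; apply: functional_extensionality_dep => i.
by apply: pmvf_meet_mull; apply: (congr1 (fun u : P => u i) xy0).
Qed.

HB.instance Definition _ := MVAlgebra_isPMVf.Build P
  pmulA pmul_subr pmul_subl pmeet_mulr pmeet_mull.

Let pscale_sub a (x y : P) :
  pscale a (x ⊙ y^*) = pscale a x ⊙ (pscale a y)^*.
Proof. by apply: functional_extensionality_dep => i; apply: rmv_scale_sub. Qed.
Let psub_scale (a b : {i01 R}) (x : P) :
  pscale (Num.max 0 (a%:num - b%:num))%R%:i01%R x =
  pscale a x ⊙ (pscale b x)^*.
Proof. by apply: functional_extensionality_dep => i; apply: rmv_sub_scale. Qed.
Let pscaleA (a b : {i01 R}) (x : P) :
  pscale a (pscale b x) = pscale (a%:num * b%:num)%R%:i01%R x.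
Proof. by apply: functional_extensionality_dep => i; apply: rmv_scaleA. Qed.
Let pscale1 (x : P) : pscale 1%R%:i01%R x = x.
Proof. by apply: functional_extensionality_dep => i; apply: rmv_scale1. Qed.

HB.instance Definition _ := MVAlgebra_isRiesz.Build R P
  pscale_sub psub_scale pscaleA pscale1.

Let pscaleAl (a : {i01 R}) (x y : P) : a *: (x * y) = (a *: x) * y.
Proof. by apply: functional_extensionality_dep => i; apply: fmv_scaleAl. Qed.
Let pscaleAr (a : {i01 R}) (x y : P) : a *: (x * y) = x * (a *: y).
Proof. by apply: functional_extensionality_dep => i; apply: fmv_scaleAr. Qed.

HB.instance Definition _ := PMVf_Riesz_isFMV.Build R P pscaleAl pscaleAr.

End ProductAlgebra.

(* Up to isomorphism: A is identified with its image in the product. *)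
Definition subdirect_product (R : realType) (A : fmvType R)
    (I : Type) (B : I -> fmvType R) : Prop :=
  exists f : A -> fmv_prod B,
    [/\ fmv_morphism f, injective f &
        forall (i : I) (b : B i), exists x : A, f x i = b].

(* Main.v *)
(* If [P] is a prime MV-ideal closed under multiplication by arbitrary elements,
   then [x ~ y] iff [x ⊖ y] and [y ⊖ x] lie in [P] is a congruence, and the
   quotient is a chain because [(x ⊖ y) ∧ (y ⊖ x) = 0].  General prime ideals
   need not be closed under multiplication, but minimal ones are: the complement
   of a maximal lattice filter [F] is [{x | x ∧ y = 0 for some y in F}], which
   the f-axiom closes under multiplication.  By Zorn's lemma every nonzero
   element lies in such an [F], so these ideals intersect in [0].
   Here [x ⊖ y] stands for [x ⊙ y^*]. *)
From HB Require Import structures.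
Require Import Defs.
From mathcomp Require Import all_boot all_order all_algebra generic_quotient.
From mathcomp Require Import boolp classical_sets reals interval_inference.

Set Implicit Arguments.
Unset Strict Implicit.
Unset Printing Implicit Defensive.

Import Order.TTheory GRing.Theory Num.Theory.

Local Open Scope mv_scope.

(** * Order and lattice arithmetic of MV-algebras *)

Section MVTheory.
Variable A : mvType.
Implicit Types x y z t : A.

Lemma mv_add0x x : 0 ⊕ x = x. Proof. by rewrite mv_addC mv_addx0. Qed.

Lemma mv_add1x x : 0^* ⊕ x = 0^* :> A. Proof. by rewrite mv_addC mv_addx1. Qed.

Lemma mv_addNx x : x^* ⊕ x = 0^*.
Proof.
by have := mv_lukasiewicz x (0^*); rewrite mv_addx1 mv_negK !mv_add0x.
Qed.

Lemma mv_leE x y : (x <= y) <-> x^* ⊕ y = 0^*.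
Proof.
rewrite /mv_le /mv_odot mv_negK; split=> [<-|->]; by rewrite mv_negK.
Qed.

Lemma mv_le_addr x y : x <= x ⊕ y.
Proof. by apply/mv_leE; rewrite mv_addA mv_addNx mv_add1x. Qed.

(** Under [x <= y] the left side of the Łukasiewicz axiom collapses to [y]; its right side is
    [(y ⊖ x) ⊕ x]. *)
Lemma mv_subDK x y : x <= y -> y = x ⊕ y ⊙ x^*.
Proof.
move/mv_leE => xy; have := mv_lukasiewicz x y; rewrite xy mv_negK mv_add0x.
by rewrite /mv_odot mv_negK => {1}->; rewrite mv_addC.
Qed.

Lemma mv_le_refl x : x <= x.
Proof. by apply/mv_leE; rewrite mv_addNx. Qed.

Lemma mv_subxx x : x ⊙ x^* = 0.
Proof. exact: mv_le_refl. Qed.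

Lemma mv_le_trans y x z : x <= y -> y <= z -> x <= z.
Proof.
move=> /mv_subDK -> /mv_subDK ->; rewrite -mv_addA; exact: mv_le_addr.
Qed.

Lemma mv_le_anti x y : x <= y -> y <= x -> x = y.
Proof.
move=> /mv_leE xy /mv_leE yx; have := mv_lukasiewicz x y.
by rewrite xy yx mv_negK !mv_add0x.
Qed.

Lemma mv_le0x x : 0 <= x.
Proof. by apply/mv_leE; rewrite mv_add1x. Qed.

Lemma mv_lex0 x : x <= 0 -> x = 0.
Proof. by move=> x0; apply: mv_le_anti => //; apply: mv_le0x. Qed.

Lemma mv_le_negr x y : x <= y -> y^* <= x^*.
Proof. by move/mv_leE => xy; apply/mv_leE; rewrite mv_negK mv_addC. Qed.

Lemma mv_odotC x y : x ⊙ y = y ⊙ x.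
Proof. by rewrite /mv_odot mv_addC. Qed.

Lemma mv_odotA x y z : x ⊙ (y ⊙ z) = x ⊙ y ⊙ z.
Proof. by rewrite /mv_odot !mv_negK mv_addA. Qed.

Lemma mv_subDE x y z : x ⊙ (y ⊕ z)^* = x ⊙ y^* ⊙ z^*.
Proof. by rewrite -mv_odotA; congr mv_odot; rewrite /mv_odot !mv_negK. Qed.

(** Residuation: both inequalities unfold to [x ⊖ y ⊖ z = 0]. *)
Lemma mv_le_subLR x y z : (x ⊙ y^* <= z) <-> (x <= y ⊕ z).
Proof. by rewrite /mv_le mv_subDE. Qed.

Lemma mv_le_add2l z x y : x <= y -> z ⊕ x <= z ⊕ y.
Proof. by move=> /mv_subDK ->; rewrite mv_addA; apply: mv_le_addr. Qed.

Lemma mv_le_add x y z t : x <= y -> z <= t -> x ⊕ z <= y ⊕ t.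
Proof.
move=> xy zt; apply: (mv_le_trans (mv_le_add2l _ zt)).
by rewrite -!(mv_addC t); apply: mv_le_add2l.
Qed.

Lemma mv_le_odot2l z x y : x <= y -> z ⊙ x <= z ⊙ y.
Proof. by move=> xy; apply/mv_le_negr/mv_le_add2l/mv_le_negr. Qed.

Lemma mv_odot_lel x y : x ⊙ y <= x.
Proof. by rewrite -[X in _ <= X]mv_negK; apply/mv_le_negr/mv_le_addr. Qed.

Lemma mv_subK x y : x <= y ⊕ x ⊙ y^*.
Proof. by apply/mv_le_subLR/mv_le_refl. Qed.

Lemma mv_meetE x y : x `&` y = x ⊙ (x ⊙ y^*)^*.
Proof. by rewrite /mv_meet /mv_odot !mv_negK. Qed.

(** This is the negation of the Łukasiewicz axiom taken at [y^*] and [x^*]. *)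
Lemma mv_meetC x y : x `&` y = y `&` x.
Proof.
rewrite !mv_meetE /mv_odot !mv_negK; congr mv_neg.
have := mv_lukasiewicz (y^*) (x^*); rewrite !mv_negK => e.
by rewrite mv_addC (mv_addC (x^*) y) e mv_addC (mv_addC (y^*) x).
Qed.

Lemma mv_meet_lel x y : x `&` y <= x. Proof. exact: mv_odot_lel. Qed.

Lemma mv_meet_ler x y : x `&` y <= y.
Proof. by rewrite mv_meetC; apply: mv_meet_lel. Qed.

Lemma mv_meet_idr x y : y <= x -> x `&` y = y.
Proof.
rewrite mv_meetC mv_meetE => ->.
by rewrite /mv_odot mv_negK mv_addx0 mv_negK.
Qed.

Lemma mv_meet_le2 x y z t : x <= z -> y <= t -> x `&` y <= z `&` t.
Proof.
move=> xz yt; apply: (@mv_le_trans (x `&` t)).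
  by apply: mv_le_odot2l; apply: mv_le_add2l.
by rewrite !(mv_meetC _ t); apply: mv_le_odot2l; apply: mv_le_add2l.
Qed.

Lemma mv_lexI x y z : z <= x -> z <= y -> z <= x `&` y.
Proof.
by move=> zx zy; rewrite -{1}(mv_meet_idr (mv_le_refl z)); apply: mv_meet_le2.
Qed.

Lemma mv_sub_meet x y : x ⊙ (x `&` y)^* = x ⊙ y^*.
Proof.
by rewrite [x `&` y]mv_meetE -mv_meetE mv_meet_idr //; apply: mv_odot_lel.
Qed.

(** Adding [t] to [m] stays below both [x] and [y], so [m ⊕ t <= m], which says [m^* ∧ t = 0]. Since
    [t <= m^*], this meet is [t] itself. *)
Lemma mv_meet_sub0 x y : (x ⊙ y^*) `&` (y ⊙ x^*) = 0.
Proof.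
set t := _ `&` _; set m := x `&` y.
have tx : m ⊕ t <= x.
  rewrite [X in _ <= X](mv_subDK (mv_meet_lel x y)); apply: mv_le_add2l.
  by rewrite mv_sub_meet; apply: mv_meet_lel.
have ty : m ⊕ t <= y.
  rewrite [X in _ <= X](mv_subDK (mv_meet_ler x y)); apply: mv_le_add2l.
  by rewrite (mv_meetC x) mv_sub_meet; apply: mv_meet_ler.
have tm : t <= m^*.
  apply: (mv_le_trans (mv_meet_lel _ _)).
  by rewrite -mv_sub_meet mv_odotC; apply: mv_odot_lel.
have := mv_lexI tx ty; rewrite -/m /mv_le mv_odotC.
rewrite -[X in X ⊕ t]mv_negK -/(mv_meet _ _) => {}tx.
by rewrite -tx mv_meet_idr.
Qed.

(** By residuation [t ⊖ x] is below [y], and it is below [z], hence it is [0]; so [t] is below both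
    [x] and [z]. *)
Lemma mv_meet_add0 x y z : x `&` z = 0 -> y `&` z = 0 -> (x ⊕ y) `&` z = 0.
Proof.
move=> xz yz; set t := _ `&` z; have tz : t <= z by apply: mv_meet_ler.
apply: mv_lex0; rewrite -xz; apply: mv_lexI => //.
rewrite /mv_le; apply: mv_lex0; rewrite -yz; apply: mv_lexI.
  by apply/mv_le_subLR/mv_meet_lel.
exact: mv_le_trans (mv_odot_lel _ _) tz.
Qed.

(** Triangle inequality for [⊖], from which the congruence gets its transitivity. *)
Lemma mv_sub_trans x y z : x ⊙ z^* <= (x ⊙ y^*) ⊕ (y ⊙ z^*).
Proof.
apply/mv_le_subLR; apply: (mv_le_trans (mv_subK x y)).
rewrite (mv_addC (x ⊙ _)) mv_addA mv_addC [X in _ <= X]mv_addC.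
by apply/mv_le_add2l/mv_subK.
Qed.

Lemma mv_sub_add x y z t :
  (x ⊕ y) ⊙ (z ⊕ t)^* <= (x ⊙ z^*) ⊕ (y ⊙ t^*).
Proof.
apply/mv_le_subLR; have := mv_le_add (mv_subK x z) (mv_subK y t).
by rewrite !mv_addA -!(mv_addA z) (mv_addC t).
Qed.

End MVTheory.

(** * Monotonicity of products and scalar multiples *)

Section PMVfTheory.
Variable A : pmvfType.
Implicit Types x y z : A.

(* If [x <= y] then [x = y ⊖ (y ⊖ x)], so [x * z = y * z ⊖ (y ⊖ x) * z]. *)
Lemma pmv_le_mul2r z x y : x <= y -> x * z <= y * z.
Proof.
move=> xy; have := pmv_mul_subl y (y ⊙ x^*) z.
rewrite mv_sub_meet -mv_meetE mv_meet_idr // => ->; exact: mv_odot_lel.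
Qed.

Lemma pmv_le_mul2l z x y : x <= y -> z * x <= z * y.
Proof.
move=> xy; have := pmv_mul_subr y (y ⊙ x^*) z.
rewrite mv_sub_meet -mv_meetE mv_meet_idr // => ->; exact: mv_odot_lel.
Qed.

(** The axiom computes the right side as [x * z ⊖ (x ∧ y) * z], and [(x ∧ y) * z <= y * z] by
    monotonicity. *)
Lemma pmv_sub_mull x y z : (x * z) ⊙ (y * z)^* <= (x ⊙ y^*) * z.
Proof.
rewrite -(mv_sub_meet x) pmv_mul_subl.
by apply/mv_le_odot2l/mv_le_negr/pmv_le_mul2r/mv_meet_ler.
Qed.

Lemma pmv_sub_mulr x y z : (z * x) ⊙ (z * y)^* <= z * (x ⊙ y^*).
Proof.
rewrite -(mv_sub_meet x) pmv_mul_subr.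
by apply/mv_le_odot2l/mv_le_negr/pmv_le_mul2l/mv_meet_ler.
Qed.

End PMVfTheory.

(** Writing [x] as [1 x], the difference [a x ⊖ 1 x] is [max(0, a - 1) x], a multiple by zero; and a
    zero scalar [b] equals [max(0, b - b)], so [b x = b x ⊖ b x = 0]. *)
Lemma rmv_scale_le (R : realType) (A : rieszMVType R) (a : {i01 R}) (x : A) :
  a *: x <= x.
Proof.
have scale0 (b : {i01 R}) : (b%:num = 0)%R -> b *: x = 0.
  move=> b0; have <- : (Num.max 0 (b%:num - b%:num))%R%:i01%R = b.
    by apply/val_inj; rewrite /= subrr b0 maxxx.
  by rewrite rmv_sub_scale; apply: mv_subxx.
rewrite /mv_le -{2}(rmv_scale1 x) -rmv_sub_scale; apply: scale0 => /=.
by apply/max_idPl; rewrite subr_le0.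
Qed.

(* Closure under scaling is automatic, since [a *: x <= x]. *)
Record prime_fideal (R : realType) (A : fmvType R) := PrimeFIdeal {
  fideal_set :> A -> Prop;
  fideal0 : fideal_set 0;
  fideal_le : forall x y, x <= y -> fideal_set y -> fideal_set x;
  fidealD : forall x y, fideal_set x -> fideal_set y -> fideal_set (x ⊕ y);
  fidealMr : forall z x, fideal_set x -> fideal_set (x * z);
  fidealMl : forall z x, fideal_set x -> fideal_set (z * x);
  fideal_prime : forall x y,
    fideal_set (x `&` y) -> fideal_set x \/ fideal_set y }.

(** * The totally ordered quotient by a prime ideal *)

Section Quotient.
Variables (R : realType) (A : fmvType R) (P : prime_fideal A).
Implicit Types x y z : A.

(** [{classic A}] gives the bare carrier the choice structure, and the boolean reflection the [rel],
    on which the quotient is built. *)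
Definition fideal_cong : rel {classic A} :=
  fun x y => `[< P (x ⊙ y^*) /\ P (y ⊙ x^*) >].

Lemma fideal_cong_refl : reflexive fideal_cong.
Proof. by move=> x; apply/asboolP; rewrite mv_subxx; split; apply: fideal0. Qed.

Lemma fideal_cong_sym : symmetric fideal_cong.
Proof. by move=> x y; apply/asboolP/asboolP => -[]. Qed.

Lemma fideal_sub_trans x y z : P (x ⊙ y^*) -> P (y ⊙ z^*) -> P (x ⊙ z^*).
Proof.
by move=> xy yz; apply: fideal_le (mv_sub_trans x y z) (fidealD xy yz).
Qed.

Lemma fideal_cong_trans : transitive fideal_cong.
Proof.
move=> y x z /asboolP[xy yx] /asboolP[yz zy]; apply/asboolP.
by split; apply: (@fideal_sub_trans _ y).
Qed.

Canonical fideal_equiv :=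
  EquivRel fideal_cong fideal_cong_refl fideal_cong_sym fideal_cong_trans.

Definition fideal_quot := {eq_quot fideal_equiv}%qT.
Local Notation Q := fideal_quot.

Definition qpi (x : A) : Q := (\pi_Q (x : {classic A}))%qT.
Definition qrepr (q : Q) : A := repr q.

Lemma qreprK q : qpi (qrepr q) = q. Proof. exact: reprK. Qed.

Lemma qpiP x y : qpi x = qpi y <-> P (x ⊙ y^*) /\ P (y ⊙ x^*).
Proof.
split=> [/eqmodP/asboolP //|xy].
by apply/eqmodP/asboolP.
Qed.

Lemma qpi_repr x : P (qrepr (qpi x) ⊙ x^*) /\ P (x ⊙ (qrepr (qpi x))^*).
Proof. by apply/qpiP; rewrite qreprK. Qed.

Let qadd (p q : Q) := qpi (qrepr p ⊕ qrepr q).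
Let qneg (p : Q) := qpi (qrepr p)^*.
Let qmul (p q : Q) := qpi (qrepr p * qrepr q).
Let qscale (a : {i01 R}) (p : Q) := qpi (a *: qrepr p).

Let qpiD x y : qadd (qpi x) (qpi y) = qpi (x ⊕ y).
Proof.
have [rx xr] := qpi_repr x; have [ry yr] := qpi_repr y.
by apply/qpiP; split; apply: fideal_le (mv_sub_add _ _ _ _) (fidealD _ _).
Qed.

Let qpiN x : qneg (qpi x) = qpi x^*.
Proof.
have [rx xr] := qpi_repr x.
by apply/qpiP; rewrite !mv_negK; split; rewrite mv_odotC.
Qed.

Let qpiM x y : qmul (qpi x) (qpi y) = qpi (x * y).
Proof.
have [rx xr] := qpi_repr x; have [ry yr] := qpi_repr y.
(* One factor is replaced at a time; each difference is bounded by a product having a factor in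
   [P]. *)
apply/qpiP; split; apply: (@fideal_sub_trans _ (x * qrepr (qpi y))).
- exact: fideal_le (pmv_sub_mull _ _ _) (fidealMr _ rx).
- exact: fideal_le (pmv_sub_mulr _ _ _) (fidealMl _ ry).
- exact: fideal_le (pmv_sub_mulr _ _ _) (fidealMl _ yr).
- exact: fideal_le (pmv_sub_mull _ _ _) (fidealMr _ xr).
Qed.

Let qpiZ a x : qscale a (qpi x) = qpi (a *: x).
Proof.
have [rx xr] := qpi_repr x; apply/qpiP; rewrite -!rmv_scale_sub.
by split; apply: fideal_le (rmv_scale_le _ _) _.
Qed.

Let qaddA p q r : qadd p (qadd q r) = qadd (qadd p q) r.
Proof. by rewrite -(qreprK p) -(qreprK q) -(qreprK r) !qpiD mv_addA. Qed.
Let qaddC p q : qadd p q = qadd q p.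
Proof. by rewrite -(qreprK p) -(qreprK q) !qpiD mv_addC. Qed.
Let qaddx0 p : qadd p (qpi 0) = p.
Proof. by rewrite -(qreprK p) qpiD mv_addx0. Qed.
Let qnegK p : qneg (qneg p) = p.
Proof. by rewrite -(qreprK p) !qpiN mv_negK. Qed.
Let qaddx1 p : qadd p (qneg (qpi 0)) = qneg (qpi 0).
Proof. by rewrite -(qreprK p) qpiN qpiD mv_addx1. Qed.
Let qlukasiewicz p q :
  qadd (qneg (qadd (qneg p) q)) q = qadd (qneg (qadd (qneg q) p)) p.
Proof.
by rewrite -(qreprK p) -(qreprK q) !(qpiN, qpiD) mv_lukasiewicz.
Qed.

HB.instance Definition _ := isMVAlgebra.Build Q
  qaddA qaddC qaddx0 qnegK qaddx1 qlukasiewicz.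

Lemma qpi_add x y : qpi x ⊕ qpi y = qpi (x ⊕ y). Proof. exact: qpiD. Qed.
Lemma qpi_neg x : (qpi x)^* = qpi x^*. Proof. exact: qpiN. Qed.

Lemma qpi_odot x y : qpi x ⊙ qpi y = qpi (x ⊙ y).
Proof. by rewrite /mv_odot !(qpi_neg, qpi_add). Qed.

Lemma qpi_meet x y : qpi x `&` qpi y = qpi (x `&` y).
Proof. by rewrite /mv_meet !(qpi_neg, qpi_add, qpi_odot). Qed.

Lemma qpi_eq0 x : qpi x = 0 <-> P x.
Proof.
rewrite (_ : 0 = qpi 0) // qpiP (mv_le0x x : 0 ⊙ x^* = 0).
rewrite /mv_odot mv_negK mv_addx0 mv_negK.
by split=> [[]|Px] //; split=> //; apply: fideal0.
Qed.

Let qmulA p q r : qmul p (qmul q r) = qmul (qmul p q) r.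
Proof. by rewrite -(qreprK p) -(qreprK q) -(qreprK r) !qpiM pmv_mulA. Qed.
Let qmul_subr (p q r : Q) :
  qmul r (p ⊙ (p `&` q)^*) = qmul r p ⊙ (qmul r (p `&` q))^*.
Proof.
rewrite -(qreprK p) -(qreprK q) -(qreprK r) qpi_meet qpi_neg qpi_odot !qpiM.
by rewrite qpi_neg qpi_odot pmv_mul_subr.
Qed.
Let qmul_subl (p q r : Q) :
  qmul (p ⊙ (p `&` q)^*) r = qmul p r ⊙ (qmul (p `&` q) r)^*.
Proof.
rewrite -(qreprK p) -(qreprK q) -(qreprK r) qpi_meet qpi_neg qpi_odot !qpiM.
by rewrite qpi_neg qpi_odot pmv_mul_subl.
Qed.
(** The meet of representatives is only in [P], perhaps nonzero, so the f-axiom of [A] does not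
    apply directly. Primeness puts one representative in [P], which absorbs products. *)
Let qmeet_mulr (p q r : Q) : p `&` q = 0 -> qmul p r `&` q = 0.
Proof.
rewrite -(qreprK p) -(qreprK q) -(qreprK r) qpiM !qpi_meet !qpi_eq0.
case/fideal_prime => Px.
  by apply: fideal_le (mv_meet_lel _ _) _; apply: fidealMr.
exact: fideal_le (mv_meet_ler _ _) Px.
Qed.
Let qmeet_mull (p q r : Q) : p `&` q = 0 -> qmul r p `&` q = 0.
Proof.
rewrite -(qreprK p) -(qreprK q) -(qreprK r) qpiM !qpi_meet !qpi_eq0.
case/fideal_prime => Px.
  by apply: fideal_le (mv_meet_lel _ _) _; apply: fidealMl.
exact: fideal_le (mv_meet_ler _ _) Px.
Qed.

HB.instance Definition _ := MVAlgebra_isPMVf.Build Q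
  qmulA qmul_subr qmul_subl qmeet_mulr qmeet_mull.

Let qscale_sub a (p q : Q) : qscale a (p ⊙ q^*) = qscale a p ⊙ (qscale a q)^*.
Proof.
rewrite -(qreprK p) -(qreprK q) qpi_neg qpi_odot !qpiZ qpi_neg qpi_odot.
by rewrite rmv_scale_sub.
Qed.
Let qsub_scale (a b : {i01 R}) (p : Q) :
  qscale (Num.max 0 (a%:num - b%:num))%R%:i01%R p =
  qscale a p ⊙ (qscale b p)^*.
Proof. by rewrite -(qreprK p) !qpiZ qpi_neg qpi_odot rmv_sub_scale. Qed.
Let qscaleA (a b : {i01 R}) (p : Q) :
  qscale a (qscale b p) = qscale (a%:num * b%:num)%R%:i01%R p.
Proof. by rewrite -(qreprK p) !qpiZ rmv_scaleA. Qed.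
Let qscale1 (p : Q) : qscale 1%R%:i01%R p = p.
Proof. by rewrite -(qreprK p) qpiZ rmv_scale1. Qed.

HB.instance Definition _ := MVAlgebra_isRiesz.Build R Q
  qscale_sub qsub_scale qscaleA qscale1.

Let qscaleAl (a : {i01 R}) (p q : Q) : a *: (p * q) = (a *: p) * q.
Proof.
rewrite -(qreprK p) -(qreprK q); rewrite -[LHS]/(qscale _ (qmul _ _)).
by rewrite -[RHS]/(qmul (qscale _ _) _) !(qpiM, qpiZ) fmv_scaleAl.
Qed.
Let qscaleAr (a : {i01 R}) (p q : Q) : a *: (p * q) = p * (a *: q).
Proof.
rewrite -(qreprK p) -(qreprK q); rewrite -[LHS]/(qscale _ (qmul _ _)).
by rewrite -[RHS]/(qmul _ (qscale _ _)) !(qpiM, qpiZ) fmv_scaleAr.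
Qed.

HB.instance Definition _ := PMVf_Riesz_isFMV.Build R Q qscaleAl qscaleAr.

Lemma qpi_morphism : fmv_morphism (qpi : A -> (Q : fmvType R)).
Proof.
split=> [//|x y|x|x y|a x]; apply: esym.
- exact: qpiD.
- exact: qpiN.
- exact: qpiM.
- exact: qpiZ.
Qed.

Lemma fideal_quot_total : mv_totally_ordered Q.
Proof.
move=> p q; rewrite -(qreprK p) -(qreprK q) /mv_le !qpi_neg !qpi_odot !qpi_eq0.
by apply: fideal_prime; rewrite mv_meet_sub0; apply: fideal0.
Qed.

End Quotient.

(** * Maximal lattice filters and separation of nonzero elements *)

Section Separation.
Local Open Scope classical_set_scope.
Variables (R : realType) (A : fmvType R).
Implicit Types (x y z a : A) (F G : set A).

(** Proper lattice filters, with the empty set allowed so that the union of an empty chain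
    qualifies. *)
Definition mv_filter F :=
  [/\ ~ F 0, forall x y, F x -> mv_le x y -> F y &
      forall x y, F x -> F y -> F (mv_meet x y)].

Section MaximalFilter.
Variable F : set A.
Hypotheses (filterF : mv_filter F) (neF : F !=set0).
Hypothesis maxF : forall G, mv_filter G -> F `<=` G -> G `<=` F.

(** If [x] meets no element of [F] in [0], the filter [G] generated by [F] and [x] is proper, so
    maximality forces [x] into [F]. *)
Lemma maximal_filterNP x : ~ F x <-> exists2 y, F y & mv_meet x y = 0%MV.
Proof.
have [F0 Fle FI] := filterF; split=> [nFx|[y Fy xy0] Fx]; last first.
  by apply: F0; rewrite -xy0; apply: FI.
apply: contrapT => noy; apply: nFx.
pose G := [set z | exists2 y, F y & mv_le (mv_meet x y) z].
have [y0 Fy0] := neF.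
apply: (maxF (G := G)); last by exists y0 => //; apply: mv_meet_lel.
- split=> [[y Fy /mv_lex0 xy0]|u v [y Fy xyu] uv|u v [y Fy xyu] [z Fz xzv]].
  + by apply: noy; exists y.
  + by exists y => //; apply: mv_le_trans uv.
  + exists (mv_meet y z); first exact: FI.
    apply: mv_lexI; [apply: mv_le_trans xyu | apply: mv_le_trans xzv];
      apply: mv_meet_le2;
      by [apply: mv_le_refl|apply: mv_meet_lel|apply: mv_meet_ler].
- by move=> y Fy; exists y => //; apply: mv_meet_ler.
Qed.

Lemma maximal_filter_fideal :
  exists P : prime_fideal A, P = ~` F :> (A -> Prop).
Proof.
have [F0 Fle FI] := filterF.
unshelve eexists; [apply: (@PrimeFIdeal R A (~` F)) => // | by []].
- by move=> x y xy nFy Fx; apply: nFy; apply: Fle xy.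
- move=> x y /maximal_filterNP[u Fu xu0] /maximal_filterNP[v Fv yv0].
  (* The common witness [u ∧ v] annihilates both [x] and [y], hence also their sum. *)
  apply/maximal_filterNP; exists (mv_meet u v); first exact: FI.
  have le0 s t w : mv_meet s w = 0%MV -> mv_le t w -> mv_meet s t = 0%MV.
    move=> sw0 tw; apply: mv_lex0; rewrite -sw0.
    by apply: mv_meet_le2 => //; apply: mv_le_refl.
  apply: mv_meet_add0; [apply: le0 xu0 _ | apply: le0 yv0 _];
    [exact: mv_meet_lel | exact: mv_meet_ler].
- move=> z x /maximal_filterNP[u Fu xu0]; apply/maximal_filterNP.
  by exists u => //; apply: pmvf_meet_mulr.
- move=> z x /maximal_filterNP[u Fu xu0]; apply/maximal_filterNP.
  by exists u => //; apply: pmvf_meet_mull.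
- move=> x y nFxy; apply/not_andP => -[Fx Fy]; apply: nFxy; exact: FI.
Qed.

End MaximalFilter.

Lemma prime_fideal_separation a : a <> 0%MV -> exists P : prime_fideal A, ~ P a.
Proof.
(* Containing [a] is required of nonempty members only, which keeps the empty chain within Zorn's
   lemma. *)
move=> a0; pose C : set (set A) := [set F | mv_filter F /\ (F !=set0 -> F a)].
have [F [[filterF Fa] maxF]] : exists F, C F /\ forall G, F `<` G -> ~ C G.
  apply: Zorn_bigcup => K KC tot; split; last first.
    by move=> [x [F KF Fx]]; exists F => //; apply: (KC F KF).2; exists x.
  split=> [[F KF F0]|x y [F KF Fx] xy|x y [F KF Fx] [G KG Gy]].
  - by have [[]] := KC F KF.
  - by exists F => //; have [[_ Fle _] _] := KC F KF; apply: Fle xy.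
  - have [FG|GF] := tot _ _ KF KG.
      by exists G => //; have [[_ _ GI] _] := KC G KG; apply: GI => //; apply: FG.
    by exists F => //; have [[_ _ FI] _] := KC F KF; apply: FI => //; apply: GF.
have up_a : C [set x | mv_le a x].
  split; last by move=> _; apply: mv_le_refl.
  split=> [/mv_lex0 //|x y ax xy|x y ax ay].
    exact: mv_le_trans xy.
  exact: mv_lexI.
(* An empty [F] would be properly contained in the principal filter of [a], which is proper because
   [a] is nonzero. *)
have neF : F !=set0.
  apply/set0P/eqP => F0; apply: (maxF _ _ up_a); rewrite F0 properEneq.
  split=> //; apply/eqP => e; have : [set x | mv_le a x] a by apply: mv_le_refl.
  by rewrite -e.
(* Every filter above [F] contains [a] and so lies in [C]: maximality in [C] is maximality among all
   filters. *)
have maxF' G : mv_filter G -> F `<=` G -> G `<=` F.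
  move=> filterG FG; apply: contrapT => GF; apply: (maxF G); first by split.
  by split=> // _; apply/FG/Fa.
have [P PE] := maximal_filter_fideal filterF neF maxF'.
by exists P; rewrite PE; apply; apply: Fa.
Qed.

End Separation.

Theorem theorem2p8 (R : realType) (A : fmvType R) :
  exists (I : Type) (B : I -> fmvType R),
    (forall i : I, mv_totally_ordered (B i)) /\ subdirect_product A B.
Proof.
exists (prime_fideal A), (fun P => fideal_quot P : fmvType R).
split; first exact: fideal_quot_total.
exists (fun x P => qpi P x); split.
- by split=> *; apply: functional_extensionality_dep => P;
    rewrite (fmv_morph0, fmv_morphD, fmv_morphN, fmv_morphM, fmv_morphZ) //;
    apply: qpi_morphism.
- move=> x y xy.
  (* A nonzero [z ⊖ t] would be excluded from some prime ideal, so the quotients jointly detect the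
     order. *)
  have le z t : (forall P : prime_fideal A, P (z ⊙ t^*)) -> z <= t.
    by move=> zt; apply: contrapT => /prime_fideal_separation[P]; apply.
  have xyP P : qpi P x = qpi P y by apply: (congr1 (fun f => f P) xy).
  by apply: mv_le_anti; apply: le => P; have /qpiP[] := xyP P.
- by move=> P q; exists (qrepr q); apply: qreprK.
Qed.
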